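(* Let $\mathcal{B}=(a_1,a_2)\subset\mathbb{R}$, $\tau>0$, and let $\rho_0>0$ and $c>0$ be constants. Let $u^0$ be a smooth field on $\mathcal{B}\times[0,\tau]$, and for $i=0,1,2,\dots$ define $$u^{i+1}=\frac{\rho_0}{2}\left(\frac{\partial u^i}{\partial t}\right)^2+\frac{c}{2}\left(\frac{\partial u^i}{\partial x}\right)^2,\qquad L^i=\frac{\rho_0}{2}\left(\frac{\partial u^i}{\partial t}\right)^2-\frac{c}{2}\left(\frac{\partial u^i}{\partial x}\right)^2 .$$ Suppose that for $i=0,1,2,\dots$ the field $u^i$ solves the variational problem $$\delta^i\int_0^\tau\int_{\mathcal{B}}L^i\,dx\,dt=0$$ and has compact support on $\mathcal{B}$. Then for every $i\in\mathbb{N}$ $$\mathcal{H}^i(t)=\int_{\mathcal{B}}\frac12\left(\rho_0\left(\frac{\partial u^i}{\partial t}\right)^2+c\left(\frac{\partial u^i}{\partial x}\right)^2\right)dx$$ is an integral of motion, that is, $\mathcal{H}^i(t)=\mathcal{H}^i(0)$ for all $t\in[0,\tau]$.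
   Context: $\delta^i$ denotes the variation with respect to $u^i$, treated as an independent field: $u^i$ solves the variational problem if $\frac{d}{d\epsilon}\big|_{\epsilon=0}\int_0^\tau\int_{\mathcal{B}}\left[\frac{\rho_0}{2}(\partial_t(u^i+\epsilon\varphi))^2-\frac{c}{2}(\partial_x(u^i+\epsilon\varphi))^2\right]dx\,dt=0$ for every smooth $\varphi$ compactly supported in $\mathcal{B}\times(0,\tau)$. ''Compact support on $\mathcal{B}$'' means there is a compact $K\subset\mathcal{B}$ with $u^i(x,t)=0$ for all $x\notin K$ and all $t\in[0,\tau]$. *)

(* Defs.v *)
From Stdlib Require Import Reals List.
From Coquelicot Require Import Coquelicot.
Open Scope R_scope.

(* Fields are total functions [u : R -> R -> R], read as [u x t]; only their
   values for x in B = (a1,a2) and t in [0,tau] are meaningful. *)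

(* Open-cover compactness; Stdlib's [compact] is restricted to subsets of R. *)
Definition compact_set {T : UniformSpace} (K : T -> Prop) : Prop :=
  forall (J : Type) (U : J -> T -> Prop),
    (forall j, open (U j)) ->
    (forall p, K p -> exists j, U j p) ->
    exists l : list J, forall p, K p -> exists j, In j l /\ U j p.

(* Meant for O open: then it is C^infinity regularity on O. *)
Definition smooth_on (O : R * R -> Prop) (f : R -> R -> R) : Prop :=
  forall (n : nat) (x t : R), O (x, t) -> ex_diff_n f n x t.

(* [(a1,a2) x [0,tau]] is not open: smoothness means being the restriction of
   a function that is smooth on an open neighbourhood. *)
Definition smooth_field (a1 a2 tau : R) (u : R -> R -> R) : Prop :=
  exists (O : R * R -> Prop) (U : R -> R -> R),
    open O /\ smooth_on O U /\
    forall x t, a1 < x < a2 -> 0 <= t <= tau -> O (x, t) /\ U x t = u x t.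

Definition Dx (u : R -> R -> R) (x t : R) : R := Derive (fun y => u y t) x.

(* The time derivative is taken within [0,tau], hence is one-sided at 0 and
   at tau; meaningful for t in [0,tau] only. *)
Definition Dt (tau : R) (u : R -> R -> R) (x t : R) : R :=
  iota (fun l : R =>
    filterdiff (u x) (within (fun s => 0 <= s <= tau) (locally t))
               (fun h : R => scal h l)).

Definition lagrangian (rho0 c tau : R) (u : R -> R -> R) (x t : R) : R :=
  rho0 / 2 * (Dt tau u x t) ^ 2 - c / 2 * (Dx u x t) ^ 2.

Fixpoint field (rho0 c tau : R) (u0 : R -> R -> R) (i : nat) : R -> R -> R :=
  match i with
  | O => u0
  | S j => fun x t =>
      let u := field rho0 c tau u0 j in
      rho0 / 2 * (Dt tau u x t) ^ 2 + c / 2 * (Dx u x t) ^ 2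
  end.

Definition action (a1 a2 rho0 c tau : R) (u : R -> R -> R) : R :=
  RInt (fun t => RInt (fun x => lagrangian rho0 c tau u x t) a1 a2) 0 tau.

(* Test functions are identified with their extension by zero to R^2. *)
Definition test_function (a1 a2 tau : R) (phi : R -> R -> R) : Prop :=
  smooth_on (fun _ => True) phi /\
  exists K : R * R -> Prop,
    compact_set K /\
    (forall x t, K (x, t) -> a1 < x < a2 /\ 0 < t < tau) /\
    (forall x t, ~ K (x, t) -> phi x t = 0).

Definition solves_variational_problem (a1 a2 rho0 c tau : R)
    (u : R -> R -> R) : Prop :=
  forall phi : R -> R -> R, test_function a1 a2 tau phi ->
    is_derive (fun eps : R =>
      action a1 a2 rho0 c tau (fun x t => u x t + eps * phi x t)) 0 0.

Definition compact_support_on (a1 a2 tau : R) (u : R -> R -> R) : Prop :=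
  exists K : R -> Prop,
    compact_set K /\
    (forall x, K x -> a1 < x < a2) /\
    (forall x t, a1 < x < a2 -> ~ K x -> 0 <= t <= tau -> u x t = 0).

Definition energy (a1 a2 rho0 c tau : R) (u : R -> R -> R) (t : R) : R :=
  RInt (fun x => 1 / 2 * (rho0 * (Dt tau u x t) ^ 2 + c * (Dx u x t) ^ 2)) a1 a2.

(* Main.v *)
(* Energy is the Noether charge of time translation, so the action is tested
   only with phi = b(t) u_t, where b is a bump function in (0,tau); phi has
   compact support because u has compact support in x.  With the kinetic density
   T = rho0/2 u_t^2 and the energy density E, the integrand of the first variation
   is 2 d/dt (b T) - b dE/dt, and the first term integrates to zero.  Hence
   the integral of b(t) H'(t) over (0,tau) vanishes for every b, so H' = 0.
   The next field is the energy density of the previous one, hence smooth, and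
   the argument applies to every field. *)
From Stdlib Require Import Reals Lra Lia List Classical ClassicalEpsilon.
From Coquelicot Require Import Coquelicot.
(* Last, so that [Dx] is not shadowed by the one of [Stdlib.Reals.Rderiv]. *)
Require Import Defs.
Open Scope R_scope.

(** A field is controlled only on the strip, whereas calculus wants open neighbourhoods. Derivatives
    are therefore computed two-sidedly, with [dt], on a smooth extension [U] defined near the strip,
    and [Dt_eq] carries the results back to [Dt]. The open set [O] need not reach x = a1 or x = a2,
    and [U] is arbitrary off the strip. Hence the support is enclosed in some [b1,b2] inside
    (a1,a2), integrals in x are reduced to [b1,b2], and the test function is cut off outside it. No
    Euler-Lagrange equation is derived. With V = c/2 u_x^2 and phi = b u_t, one has rho0 u_t phi_t =
    2 b' T + b T' and c u_x phi_x = b V', primes being time derivatives; the difference is 2 (b T)'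
    - b (T' + V'). This holds pointwise, so nothing is integrated by parts in x. *)

(** * Functions of class C^n on an open set of the plane *)

Definition dt (f : R -> R -> R) (x t : R) : R := Derive (fun s => f x s) t.

(** [smooth_on] at a fixed order, so that closure properties can be proved by induction on the
    order. *)
Definition diff_on (n : nat) (O : R * R -> Prop) (f : R -> R -> R) : Prop :=
  forall x t, O (x, t) -> ex_diff_n f n x t.

Lemma open_locally_2d (O : R * R -> Prop) (x t : R) :
  open O -> O (x, t) -> locally_2d (fun u v => O (u, v)) x t.
Proof.
intros hO h. apply locally_2d_locally.
generalize (hO _ h). apply filter_imp. now intros [u v].
Qed.

Lemma diff_on_ext (n : nat) (O : R * R -> Prop) (f g : R -> R -> R) :
  open O -> (forall x t, O (x, t) -> f x t = g x t) ->
  diff_on n O f -> diff_on n O g.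
Proof.
intros hO e hf x t h. apply ex_diff_n_ext_loc with f; [|now apply hf].
destruct (open_locally_2d O x t hO h) as [d hd]. exists d. auto.
Qed.

(** Differentiability of order n depends on local values only, so on an open set explicit candidates
    [f1] and [f2] can stand for the partial derivatives that [ex_diff_n] expresses with [Derive]. *)
Lemma diff_on_S (n : nat) (O : R * R -> Prop) (f f1 f2 : R -> R -> R) :
  open O ->
  (forall x t, O (x, t) -> continuity_2d_pt f x t) ->
  (forall x t, O (x, t) -> is_derive (fun y => f y t) x (f1 x t)) ->
  (forall x t, O (x, t) -> is_derive (fun s => f x s) t (f2 x t)) ->
  diff_on n O f1 -> diff_on n O f2 -> diff_on (S n) O f.
Proof.
intros hO hf h1 h2 d1 d2.
assert (e1 : diff_on n O (Dx f)).
{ apply diff_on_ext with f1; trivial.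
  intros x t h. symmetry. now apply is_derive_unique, h1. }
assert (e2 : diff_on n O (dt f)).
{ apply diff_on_ext with f2; trivial.
  intros x t h. symmetry. now apply is_derive_unique, h2. }
intros x t h. simpl. split; [auto|split; [|split; [|split]]].
- eexists; now apply h1.
- eexists; now apply h2.
- now apply e1.
- now apply e2.
Qed.

Lemma diff_on_le (m n : nat) (O : R * R -> Prop) (f : R -> R -> R) :
  (m <= n)%nat -> diff_on n O f -> diff_on m O f.
Proof. intros hm hf x t h. now apply ex_diff_n_m with n; [|apply hf]. Qed.

Lemma diff_on_continuity (n : nat) (O : R * R -> Prop) (f : R -> R -> R) x t :
  diff_on n O f -> O (x, t) -> continuity_2d_pt f x t.
Proof. intros hf h. specialize (hf x t h). destruct n; apply hf. Qed.

Lemma diff_on_is_derive_x (n : nat) (O : R * R -> Prop) (f : R -> R -> R) x t :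
  diff_on (S n) O f -> O (x, t) -> is_derive (fun y => f y t) x (Dx f x t).
Proof. intros hf h. apply Derive_correct, (hf x t h). Qed.

Lemma diff_on_is_derive_t (n : nat) (O : R * R -> Prop) (f : R -> R -> R) x t :
  diff_on (S n) O f -> O (x, t) -> is_derive (fun s => f x s) t (dt f x t).
Proof. intros hf h. apply Derive_correct, (hf x t h). Qed.

Lemma diff_on_Dx (n : nat) (O : R * R -> Prop) (f : R -> R -> R) :
  diff_on (S n) O f -> diff_on n O (Dx f).
Proof. intros hf x t h. apply (hf x t h). Qed.

Lemma diff_on_dt (n : nat) (O : R * R -> Prop) (f : R -> R -> R) :
  diff_on (S n) O f -> diff_on n O (dt f).
Proof. intros hf x t h. apply (hf x t h). Qed.

Lemma diff_on_const (n : nat) (O : R * R -> Prop) (k : R) :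
  open O -> diff_on n O (fun _ _ => k).
Proof.
intros hO. revert k. induction n as [|n IH]; intros k.
- intros x t h. split; trivial. apply continuity_2d_pt_const.
- apply diff_on_S with (fun _ _ => 0) (fun _ _ => 0); trivial; intros;
    try apply continuity_2d_pt_const; apply @is_derive_const.
Qed.

Lemma diff_on_plus (n : nat) (O : R * R -> Prop) (f g : R -> R -> R) :
  open O -> diff_on n O f -> diff_on n O g ->
  diff_on n O (fun x t => f x t + g x t).
Proof.
intros hO. revert f g. induction n as [|n IH]; intros f g hf hg.
- intros x t h. split; trivial.
  apply continuity_2d_pt_plus; eapply diff_on_continuity; eauto.
- apply diff_on_S with (fun x t => Dx f x t + Dx g x t)
    (fun x t => dt f x t + dt g x t); trivial.
  + intros x t h. apply continuity_2d_pt_plus; eapply diff_on_continuity; eauto.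
  + intros x t h. apply @is_derive_plus; eapply diff_on_is_derive_x; eauto.
  + intros x t h. apply @is_derive_plus; eapply diff_on_is_derive_t; eauto.
  + apply IH; now apply diff_on_Dx.
  + apply IH; now apply diff_on_dt.
Qed.

Lemma diff_on_mult (n : nat) (O : R * R -> Prop) (f g : R -> R -> R) :
  open O -> diff_on n O f -> diff_on n O g ->
  diff_on n O (fun x t => f x t * g x t).
Proof.
intros hO. revert f g. induction n as [|n IH]; intros f g hf hg.
- intros x t h. split; trivial.
  apply continuity_2d_pt_mult; eapply diff_on_continuity; eauto.
- assert (hf' := diff_on_le n (S n) O f (le_S _ _ (le_n n)) hf).
  assert (hg' := diff_on_le n (S n) O g (le_S _ _ (le_n n)) hg).
  apply diff_on_S with (fun x t => Dx f x t * g x t + f x t * Dx g x t)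
    (fun x t => dt f x t * g x t + f x t * dt g x t); trivial.
  + intros x t h. apply continuity_2d_pt_mult; eapply diff_on_continuity; eauto.
  + intros x t h. apply (is_derive_mult (fun y => f y t) (fun y => g y t));
      [eapply diff_on_is_derive_x; eauto .. | apply Rmult_comm].
  + intros x t h. apply (is_derive_mult (fun s => f x s) (fun s => g x s));
      [eapply diff_on_is_derive_t; eauto .. | apply Rmult_comm].
  + apply diff_on_plus; trivial; apply IH; trivial; now apply diff_on_Dx.
  + apply diff_on_plus; trivial; apply IH; trivial; now apply diff_on_dt.
Qed.

(** * Bump functions *)

(** The case k = 0 is the classical flat function exp(-1/x). The powers of 1/x make the span of the
    family stable under differentiation, so that smoothness follows by induction for all k at
    once. *)
Definition flat (k : nat) (x : R) : R :=
  if Rle_dec x 0 then 0 else (/ x) ^ k * exp (- / x).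

Lemma flat_nonpos (k : nat) (x : R) : x <= 0 -> flat k x = 0.
Proof. intros h. unfold flat. now destruct (Rle_dec x 0). Qed.

Lemma flat_pos (k : nat) (x : R) : 0 < x -> flat k x = (/ x) ^ k * exp (- / x).
Proof. intros h. unfold flat. destruct (Rle_dec x 0); [lra|easy]. Qed.

(** Raise z <= exp z, at z = y / m, to the power m; the case m = 0 is separate because of the
    division. *)
Lemma pow_le_exp (m : nat) (y : R) : 0 <= y -> y ^ m <= INR m ^ m * exp y.
Proof.
intros hy. destruct m as [|m].
- simpl. generalize (exp_ineq1_le y). lra.
- assert (hm : 0 < INR (S m)) by (apply lt_0_INR; lia).
  replace y with (INR (S m) * (y / INR (S m))) at 1 by (field; lra).
  rewrite Rpow_mult_distr. apply Rmult_le_compat_l; [apply pow_le; lra|].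
  replace y with (INR (S m) * (y / INR (S m))) at 2 by (field; lra).
  assert (h : forall k z, exp (INR k * z) = exp z ^ k).
  { intros k z. induction k as [|k IH].
    - simpl. now rewrite Rmult_0_l, exp_0.
    - rewrite S_INR, Rmult_plus_distr_r, Rmult_1_l, exp_plus, IH. simpl. ring. }
  rewrite h. apply pow_incr. split.
  + apply Rmult_le_pos; [easy|]. left. now apply Rinv_0_lt_compat.
  + generalize (exp_ineq1_le (y / INR (S m))). lra.
Qed.

(** This is [pow_le_exp] at 1/x with exponent k + 2: the two extra powers leave a factor x^2, which
    makes the difference quotient at 0 tend to 0. *)
Lemma flat_bound (k : nat) (x : R) :
  Rabs (flat k x) <= INR (k + 2) ^ (k + 2) * x ^ 2.
Proof.
destruct (Rle_dec x 0) as [h|h].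
- rewrite flat_nonpos, Rabs_R0 by easy.
  apply Rmult_le_pos; [apply pow_le, pos_INR | apply pow2_ge_0].
- assert (hx : 0 < x) by lra. assert (hi := Rinv_0_lt_compat x hx).
  rewrite flat_pos by easy.
  rewrite Rabs_pos_eq
    by (apply Rmult_le_pos; [apply pow_le | left; apply exp_pos]; lra).
  assert (H := pow_le_exp (k + 2) (/ x) (Rlt_le _ _ hi)).
  apply Rmult_le_compat_r with (r := exp (- / x) * x ^ 2) in H.
  2: apply Rmult_le_pos; [left; apply exp_pos | apply pow2_ge_0].
  replace (INR (k + 2) ^ (k + 2) * exp (/ x) * (exp (- / x) * x ^ 2))
    with (INR (k + 2) ^ (k + 2) * x ^ 2 * (exp (/ x) * exp (- / x))) in H by ring.
  rewrite <- exp_plus, Rplus_opp_r, exp_0, Rmult_1_r in H.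
  replace ((/ x) ^ (k + 2) * (exp (- / x) * x ^ 2))
    with ((/ x) ^ k * exp (- / x)) in H by (rewrite pow_add; field; lra).
  exact H.
Qed.

Lemma is_derive_flat (k : nat) (x : R) :
  is_derive (flat k) x (- INR k * flat (S k) x + flat (S (S k)) x).
Proof.
destruct (Rtotal_order x 0) as [h|[h|h]].
- rewrite !flat_nonpos by lra.
  apply is_derive_ext_loc with (fun _ => 0).
  + assert (hx : 0 < - x) by lra. exists (mkposreal _ hx). intros y hy.
    apply Rabs_def2 in hy. unfold minus, plus, opp in hy. simpl in hy.
    rewrite flat_nonpos; lra.
  + replace (- INR k * 0 + 0) with 0 by ring. apply @is_derive_const.
- subst x. rewrite !flat_nonpos by lra.
  replace (- INR k * 0 + 0) with 0 by ring.
  apply is_derive_Reals. intros eps heps.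
  set (C := INR (k + 2) ^ (k + 2)).
  assert (hC : 0 <= C) by apply pow_le, pos_INR.
  (* The difference quotient is at most C |y|; with C + 1 in the denominator, [0 <= C] is enough. *)
  assert (hd : 0 < eps / (C + 1)) by (apply Rdiv_lt_0_compat; lra).
  exists (mkposreal _ hd). intros y hy0 hy. simpl in hy.
  rewrite Rplus_0_l, (flat_nonpos k 0), !Rminus_0_r by lra.
  assert (hya : 0 < Rabs y) by now apply Rabs_pos_lt.
  unfold Rdiv. rewrite Rabs_mult, Rabs_inv.
  apply Rle_lt_trans with (C * Rabs y).
  + apply Rmult_le_reg_r with (Rabs y); trivial.
    rewrite Rmult_assoc, Rinv_l, Rmult_1_r by lra.
    replace (C * Rabs y * Rabs y) with (C * y ^ 2).
    * apply flat_bound.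
    * rewrite <- (pow2_abs y). ring.
  + apply Rmult_lt_compat_r with (r := C + 1) in hy; [|lra].
    replace (eps / (C + 1) * (C + 1)) with eps in hy by (field; lra). nra.
- rewrite !flat_pos by easy.
  apply is_derive_ext_loc with (fun y => (/ y) ^ k * exp (- / y)).
  + exists (mkposreal _ h). intros y hy. apply Rabs_def2 in hy.
    unfold minus, plus, opp in hy. simpl in hy. rewrite flat_pos; lra.
  + auto_derive; [lra|].
    destruct k as [|k]; simpl; [field; lra|].
    change (match k with 0%nat => 1 | S _ => INR k + 1 end) with (INR (S k)).
    field; lra.
Qed.

(** The slopes s = 1 and s = -1 give the two factors of [bump]. A function of time is read as one of
    (x, t) so that it can be multiplied by a derivative of a field. *)
Lemma flat_diff_on (p s : R) (n k : nat) :
  diff_on n (fun _ => True) (fun _ t => flat k (s * (t - p))).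
Proof.
assert (hO : open (fun _ : R * R => True)) by apply open_true.
assert (hc : forall k x t, continuity_2d_pt (fun _ t => flat k (s * (t - p))) x t).
{ intros j x t. apply (continuity_1d_2d_pt_comp (fun r => flat j (s * (r - p))) (fun _ v => v)).
  - apply derivable_continuous_pt, ex_derive_Reals_0.
    apply (ex_derive_comp (flat j) (fun r => s * (r - p))).
    + eexists. apply is_derive_flat.
    + auto_derive; trivial.
  - apply continuity_2d_pt_id2. }
revert k. induction n as [|n IH]; intros k.
- intros x t _. now split.
- apply diff_on_S with (fun _ _ => 0)
    (fun _ t => s * (- INR k * flat (S k) (s * (t - p)) + flat (S (S k)) (s * (t - p)))).
  + easy.
  + intros x t _. apply hc.
  + intros. apply @is_derive_const.
  + intros x t _.
    apply (is_derive_comp (flat k) (fun r => s * (r - p)) t _ s).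
    * apply is_derive_flat.
    * auto_derive; [easy|ring].
  + now apply diff_on_const.
  + apply diff_on_mult; [easy|now apply diff_on_const|].
    apply diff_on_plus; [easy| |apply IH].
    apply diff_on_mult; [easy|now apply diff_on_const|apply IH].
Qed.

Definition bump (p q t : R) : R := flat 0 (t - p) * flat 0 (q - t).

Lemma bump_out (p q t : R) : t <= p \/ q <= t -> bump p q t = 0.
Proof.
intros [h|h]; unfold bump.
- rewrite (flat_nonpos 0 (t - p)) by lra. ring.
- rewrite (flat_nonpos 0 (q - t)) by lra. ring.
Qed.

Lemma bump_pos (p q t : R) : p < t < q -> 0 < bump p q t.
Proof.
intros h. unfold bump. rewrite !flat_pos by lra. simpl.
rewrite !Rmult_1_l. apply Rmult_lt_0_compat; apply exp_pos.
Qed.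

Lemma bump_diff_on (p q : R) (n : nat) :
  diff_on n (fun _ => True) (fun _ t => bump p q t).
Proof.
assert (hO : open (fun _ : R * R => True)) by apply open_true.
apply diff_on_ext with (fun _ t => flat 0 (1 * (t - p)) * flat 0 (-1 * (t - q))).
- easy.
- intros x t _. unfold bump. f_equal; f_equal; ring.
- apply (diff_on_mult n _ (fun _ t => flat 0 (1 * (t - p)))); trivial; apply flat_diff_on.
Qed.

Lemma bump_continuous (p q t : R) : continuous (bump p q) t.
Proof.
apply (ex_derive_continuous (K := R_AbsRing) (V := R_NormedModule)).
eexists. now apply (diff_on_is_derive_t 0 _ _ 0 t (bump_diff_on p q 1)).
Qed.

(** * Fields on the closed strip and integrals over slices *)

(** [filterdiff] quantifies over all limits of the filter, and t is the only one. The function g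
    need agree with f on [0,tau] only, which lets an extension replace a field. *)
Lemma filterdiff_within_iff (tau t l : R) (f g : R -> R) :
  0 <= t <= tau -> (forall s, 0 <= s <= tau -> f s = g s) ->
  filterdiff f (within (fun s => 0 <= s <= tau) (locally t))
    (fun h : R => scal h l) <->
  forall eps : posreal, exists d : posreal, forall s,
    Rabs (s - t) < d -> 0 <= s <= tau ->
    Rabs (g s - g t - (s - t) * l) <= eps * Rabs (s - t).
Proof.
intros ht e. split.
- intros [_ H] eps.
  assert (hl : is_filter_lim (within (fun s => 0 <= s <= tau) (locally t)) t).
  { intros P [d hd]. exists d. intros s hs _. now apply hd. }
  destruct (H t hl eps) as [d hd]. exists d. intros s hs hs'.
  specialize (hd s hs hs'). rewrite (e s hs'), (e t ht) in hd. exact hd.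
- intros H. split; [apply (is_linear_scal_l (K := R_AbsRing) (V := R_NormedModule) l)|].
  intros y hy eps.
  assert (y = t) as ->.
  { apply NNPP. intros hne.
    assert (hp : 0 < Rabs (t - y)) by (apply Rabs_pos_lt; lra).
    destruct (hy (fun z => Rabs (z - y) < Rabs (t - y))) as [d hd].
    - exists (mkposreal _ hp). intros z hz. exact hz.
    - specialize (hd t (ball_center t d) ht). lra. }
  destruct (H eps) as [d hd]. exists d. intros s hs hs'.
  rewrite (e s hs'), (e t ht). exact (hd s hs hs').
Qed.

(** [iota] returns l only if the derivative within [0,tau] is unique. Uniqueness holds, even at the
    endpoints, because [0 < tau] provides points of [0,tau] other than t arbitrarily close to t. *)
Lemma Dt_eq (tau : R) (u : R -> R -> R) (x t : R) (g : R -> R) (l : R) :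
  0 < tau -> 0 <= t <= tau ->
  (forall s, 0 <= s <= tau -> u x s = g s) -> is_derive g t l ->
  Dt tau u x t = l.
Proof.
intros htau ht e hg.
assert (hl : forall eps : posreal, exists d : posreal, forall s,
    Rabs (s - t) < d -> 0 <= s <= tau ->
    Rabs (g s - g t - (s - t) * l) <= eps * Rabs (s - t)).
{ intros eps. destruct hg as [_ H].
  destruct (H t (fun P h => h) eps) as [d hd]. exists d.
  intros s hs _. exact (hd s hs). }
unfold Dt.
apply (iota_unique (fun l' : R => filterdiff (u x)
  (within (fun s => 0 <= s <= tau) (locally t)) (fun h : R => scal h l'))).
2: now apply filterdiff_within_iff with g.
intros l' hl'.
assert (hl2 := proj1 (filterdiff_within_iff tau t l' (u x) g ht e) hl').
apply NNPP. intros hne.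
(* Two errors of a quarter of |l' - l| add up to a half, too little to account for |l' - l|. *)
assert (hp : 0 < Rabs (l' - l) / 4).
{ assert (0 < Rabs (l' - l)) by (apply Rabs_pos_lt; lra). lra. }
destruct (hl (mkposreal _ hp)) as [d1 h1].
destruct (hl2 (mkposreal _ hp)) as [d2 h2]. simpl in h1, h2.
(* Step m/2 to the right or, if that leaves [0,tau], to the left; since m <= tau, one of the two
   stays inside. *)
assert (hs : exists s, s <> t /\ Rabs (s - t) < d1 /\ Rabs (s - t) < d2 /\ 0 <= s <= tau).
{ set (m := Rmin (Rmin d1 d2) tau).
  assert (hm : 0 < m /\ m <= d1 /\ m <= d2 /\ m <= tau).
  { unfold m. assert (h := cond_pos d1). assert (h' := cond_pos d2).
    unfold Rmin. repeat destruct Rle_dec; lra. }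
  destruct (Rle_dec (t + m / 2) tau).
  - exists (t + m / 2). replace (t + m / 2 - t) with (m / 2) by ring.
    rewrite Rabs_pos_eq by lra. lra.
  - exists (t - m / 2). replace (t - m / 2 - t) with (- (m / 2)) by ring.
    rewrite Rabs_Ropp, Rabs_pos_eq by lra. lra. }
destruct hs as [s [hst [hs1 [hs2 hs]]]].
specialize (h1 s hs1 hs). specialize (h2 s hs2 hs).
assert (hp' : 0 < Rabs (s - t)) by (apply Rabs_pos_lt; lra).
assert (H : Rabs ((s - t) * (l' - l)) <= Rabs (l' - l) / 2 * Rabs (s - t)).
{ replace ((s - t) * (l' - l)) with
    ((g s - g t - (s - t) * l) + - (g s - g t - (s - t) * l')) by ring.
  eapply Rle_trans; [apply Rabs_triang|]. rewrite Rabs_Ropp. lra. }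
rewrite Rabs_mult in H. nra.
Qed.

(** All conditions are on open intervals, because nothing is known of a field at a1 and a2;
    integrability of f itself is deduced. *)
Lemma RInt_restrict (f g : R -> R) (a p q b : R) :
  a <= p -> p <= q -> q <= b ->
  (forall x, a < x < p -> f x = 0) -> (forall x, q < x < b -> f x = 0) ->
  (forall x, p < x < q -> f x = g x) -> ex_RInt g p q ->
  RInt f a b = RInt g p q.
Proof.
intros ap pq qb f0 f1 e hg.
assert (z : forall c d, c <= d -> (forall x, c < x < d -> f x = 0) ->
  ex_RInt f c d /\ RInt f c d = 0).
{ intros c d cd h.
  assert (h' : forall x, Rmin c d < x < Rmax c d -> 0 = f x).
  { rewrite Rmin_left, Rmax_right by easy. intros x hx. now rewrite h. }
  split.
  - apply ex_RInt_ext with (fun _ => 0); trivial. apply ex_RInt_const.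
  - rewrite <- (RInt_ext (fun _ => 0) f) by easy. rewrite RInt_const.
    apply Rmult_0_r. }
assert (e' : forall x, Rmin p q < x < Rmax p q -> g x = f x).
{ rewrite Rmin_left, Rmax_right by easy. intros x hx. now rewrite e. }
assert (hf : ex_RInt f p q) by now apply ex_RInt_ext with g.
destruct (z a p) as [h1 e1]; trivial. destruct (z q b) as [h2 e2]; trivial.
rewrite <- (RInt_Chasles f a p b), <- (RInt_Chasles f p q b), e1, e2; trivial.
- rewrite (RInt_ext g f) by easy. unfold plus; simpl. ring.
- now apply ex_RInt_Chasles with q.
Qed.

(** The tube lemma, obtained from uniform continuity of the indicator of O near the compact slice:
    an oscillation below 1 forces the indicator to be constant. *)
Lemma tube (O : R * R -> Prop) (a b t : R) :
  open O -> (forall x, a <= x <= b -> O (x, t)) ->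
  exists d : posreal, forall x s, a <= x <= b -> Rabs (s - t) < d -> O (x, s).
Proof.
intros hO h.
set (chi := fun x s => if excluded_middle_informative (O (x, s)) then 1 else 0).
assert (hc : forall x, a <= x <= b -> continuity_2d_pt chi x t).
{ intros x hx. apply continuity_2d_pt_ext_loc with (fun _ _ => 1).
  - destruct (open_locally_2d O x t hO (h x hx)) as [d hd].
    exists d. intros u v hu hv. unfold chi.
    destruct excluded_middle_informative as [_|n]; [easy|]. destruct n. auto.
  - apply continuity_2d_pt_const. }
destruct (uniform_continuity_2d_1d chi a b t hc (mkposreal 1 Rlt_0_1)) as [d hd].
exists d. intros x s hx hs. simpl in hd.
assert (hs' := Rabs_def2 _ _ hs). assert (d0 := cond_pos d).
specialize (hd x t x s hx ltac:(lra) hx ltac:(lra)).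
rewrite Rminus_eq_0, Rabs_R0 in hd. specialize (hd d0). unfold chi in hd.
destruct (excluded_middle_informative (O (x, s))) as [|n]; [easy|].
destruct (excluded_middle_informative (O (x, t))) as [_|n']; [|now destruct n'; apply h].
exfalso. rewrite Rabs_left in hd; lra.
Qed.

Lemma continuity_2d_pt_slice (f : R -> R -> R) (x t : R) :
  continuity_2d_pt f x t -> continuous (fun y => f y t) x.
Proof.
intros h. apply continuity_pt_filterlim, continuity_pt_locally.
intros eps. destruct (h eps) as [d hd].
exists d. intros y hy. apply hd; [exact hy|].
rewrite Rminus_eq_0, Rabs_R0. apply cond_pos.
Qed.

Lemma continuity_2d_pt_swap (f : R -> R -> R) (x t : R) :
  continuity_2d_pt f x t -> continuity_2d_pt (fun u v => f v u) t x.
Proof. intros h eps. destruct (h eps) as [d hd]. exists d. auto. Qed.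

Lemma ex_RInt_slice (n : nat) (O : R * R -> Prop) (f : R -> R -> R) (a b t : R) :
  a <= b -> diff_on n O f -> (forall x, a <= x <= b -> O (x, t)) ->
  ex_RInt (fun x => f x t) a b.
Proof.
intros ab hf h. apply (ex_RInt_continuous (V := R_CompleteNormedModule)).
rewrite Rmin_left, Rmax_right by easy. intros x hx.
apply continuity_2d_pt_slice. eapply diff_on_continuity; eauto.
Qed.

Lemma continuous_RInt_slice (n : nat) (O : R * R -> Prop) (f : R -> R -> R) (a b t : R) :
  open O -> a <= b -> diff_on n O f -> (forall x, a <= x <= b -> O (x, t)) ->
  continuous (fun s => RInt (fun x => f x s) a b) t.
Proof.
intros hO ab hf h. destruct (tube O a b t hO h) as [d1 hd1].
apply continuity_pt_filterlim, continuity_pt_locally. intros eps.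
(* Adding 1 to the length covers the case a = b and makes the final bound strict. *)
assert (hp : 0 < eps / (b - a + 1)) by (apply Rdiv_lt_0_compat; [apply cond_pos|lra]).
destruct (uniform_continuity_2d_1d f a b t) with (mkposreal _ hp) as [d2 hd2].
{ intros x hx. eapply diff_on_continuity; eauto. }
assert (hd : 0 < Rmin d1 d2) by (apply Rmin_pos; apply cond_pos).
exists (mkposreal _ hd). intros s hs. change (Rabs (s - t) < Rmin d1 d2) in hs.
assert (hs1 := Rlt_le_trans _ _ _ hs (Rmin_l _ _)).
assert (hs2 := Rlt_le_trans _ _ _ hs (Rmin_r _ _)).
assert (i1 : ex_RInt (fun x => f x s) a b)
  by (apply ex_RInt_slice with n O; auto).
assert (i2 : ex_RInt (fun x => f x t) a b)
  by (apply ex_RInt_slice with n O; auto).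
change (Rabs (minus (RInt (fun x => f x s) a b) (RInt (fun x => f x t) a b)) < eps).
rewrite <- RInt_minus by easy.
apply Rle_lt_trans with ((b - a) * (eps / (b - a + 1))).
- apply abs_RInt_le_const; trivial.
  + now apply @ex_RInt_minus.
  + intros x hx. left. assert (hs' := Rabs_def2 _ _ hs2). assert (d0 := cond_pos d2).
    apply hd2; try lra. rewrite Rminus_eq_0, Rabs_R0. easy.
- assert (e0 := cond_pos eps).
  apply Rmult_lt_reg_r with (b - a + 1); [lra|]. field_simplify; lra.
Qed.

Lemma is_derive_RInt_slice (n : nat) (O : R * R -> Prop) (f : R -> R -> R) (a b t : R) :
  open O -> a <= b -> diff_on (S n) O f -> (forall x, a <= x <= b -> O (x, t)) ->
  is_derive (fun s => RInt (fun x => f x s) a b) t (RInt (fun x => dt f x t) a b).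
Proof.
intros hO ab hf h. destruct (tube O a b t hO h) as [d hd].
apply (is_derive_RInt_param (fun s x => f x s));
  rewrite ?Rmin_left, ?Rmax_right by easy.
- exists d. intros s hs x hx. eexists. eapply diff_on_is_derive_t; eauto.
- intros x hx. apply (continuity_2d_pt_swap (dt f)).
  eapply diff_on_continuity; [eapply diff_on_dt|]; eauto.
- exists d. intros s hs. apply ex_RInt_slice with (S n) O; auto.
Qed.

(** * Compact sets in the plane and in an interval *)

(** An open cover is turned into a gauge: choice attaches to each point of the rectangle a member of
    the cover and a radius whose square lies in it, and [compactness_list] yields finitely many
    squares. *)
Lemma compact_rectangle (a b p q : R) :
  compact_set (fun z : R * R => a <= fst z <= b /\ p <= snd z <= q).
Proof.
intros J U hU hcov.
set (good := fun z (jd : J * posreal) =>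
  forall u v, Rabs (u - fst z) < snd jd -> Rabs (v - snd z) < snd jd -> U (fst jd) (u, v)).
(* [option] is needed because points off the rectangle may be uncovered, and J may even be empty. *)
assert (hg : forall z : R * R, exists o : option (J * posreal),
  a <= fst z <= b /\ p <= snd z <= q -> exists jd, o = Some jd /\ good z jd).
{ intros [x t]. destruct (classic (a <= x <= b /\ p <= t <= q)) as [h|h].
  2: now exists None.
  destruct (hcov (x, t) h) as [j hj].
  destruct (open_locally_2d (U j) x t (hU j) hj) as [d hd].
  exists (Some (j, d)). intros _. exists (j, d). now split. }
apply choice in hg. destruct hg as [F hF].
pose (pt := fun z : Compactness.Tn 2 R => (fst z, fst (snd z))).
pose (delta := fun z => match F (pt z) with Some jd => snd jd | None => mkposreal 1 Rlt_0_1 end).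
(* [compactness_list] asserts its finite list only under a double negation. *)
apply NNPP. intros N.
apply (compactness_list 2 (a, (p, tt)) (b, (q, tt)) delta).
intros [l hl]. apply N.
exists (flat_map (fun z => match F (pt z) with Some jd => fst jd :: nil | None => nil end) l).
intros [x t] [hx ht]. simpl in hx, ht.
destruct (hl (x, (t, tt))) as [z [hz1 [hz2 hz3]]].
{ simpl. auto. }
destruct z as [x' [t' []]]. simpl in hz2, hz3.
destruct (hF (x', t')) as [[j d] [e hjd]]; [simpl; tauto|].
exists j. split.
- apply in_flat_map. exists (x', (t', tt)). split; trivial.
  unfold pt. simpl. rewrite e. now left.
- unfold delta, pt in hz3. simpl in hz3. rewrite e in hz3. now apply hjd.
Qed.

(** The nested open intervals (a + d, b - d) cover K, so a finite subcover lies in the one with the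
    smallest d. *)
Lemma compact_in_interval (a b : R) (K : R -> Prop) :
  a < b -> compact_set K -> (forall x, K x -> a < x < b) ->
  exists p q, a < p /\ p < q /\ q < b /\ forall x, K x -> p <= x <= q.
Proof.
intros ab hK hin.
destruct (hK posreal (fun d x => a + d < x < b - d)) as [l hl].
- intros d. apply open_and; [apply open_gt | apply open_lt].
- intros x hx. specialize (hin x hx).
  assert (hp : 0 < Rmin (x - a) (b - x) / 2)
    by (apply Rdiv_lt_0_compat; [apply Rmin_pos|]; lra).
  exists (mkposreal _ hp). simpl.
  assert (h1 := Rmin_l (x - a) (b - x)). assert (h2 := Rmin_r (x - a) (b - x)). lra.
(* The cap (b - a) / 3 keeps p < q and serves as d when the list is empty. *)
- assert (hd : exists d, 0 < d <= (b - a) / 3 /\ forall e, In e l -> d <= pos e).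
  { clear hl. induction l as [|e l [d [hd1 hd2]]].
    - exists ((b - a) / 3). split; [lra|easy].
    - exists (Rmin d e). assert (e0 := cond_pos e). split.
      + assert (h := Rmin_l d e). split; [apply Rmin_pos|]; lra.
      + intros e' [<-|h]; [apply Rmin_r|].
        apply Rle_trans with d; [apply Rmin_l|auto]. }
  destruct hd as [d [hd1 hd2]].
  exists (a + d), (b - d). repeat split; try lra.
  all: destruct (hl x H) as [e [he1 he2]]; specialize (hd2 e he1); lra.
Qed.

(** * The first variation and Noether's identity *)

Lemma is_derive_Rmult (f g : R -> R) (x df dg : R) :
  is_derive f x df -> is_derive g x dg ->
  is_derive (fun y => f y * g y) x (df * g x + f x * dg).
Proof. intros hf hg. apply (is_derive_mult f g); trivial. apply Rmult_comm. Qed.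

Lemma RInt_quadratic (f g h : R -> R) (a b e : R) :
  ex_RInt f a b -> ex_RInt g a b -> ex_RInt h a b ->
  RInt (fun x => f x + e * g x + e ^ 2 * h x) a b =
  RInt f a b + e * RInt g a b + e ^ 2 * RInt h a b.
Proof.
intros hf hg hh. apply is_RInt_unique.
apply (is_RInt_plus (V := R_NormedModule) (fun x => f x + e * g x)).
- apply (is_RInt_plus (V := R_NormedModule) f).
  + now apply (RInt_correct (V := R_CompleteNormedModule)).
  + apply (is_RInt_scal (V := R_NormedModule)).
    now apply (RInt_correct (V := R_CompleteNormedModule)).
- apply (is_RInt_scal (V := R_NormedModule)).
  now apply (RInt_correct (V := R_CompleteNormedModule)).
Qed.

Lemma Dx_dt_comm (O : R * R -> Prop) (f : R -> R -> R) (x t : R) :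
  open O -> diff_on 2 O f -> O (x, t) -> Dx (dt f) x t = dt (Dx f) x t.
Proof.
intros hO hf h. apply (Schwarz f).
- destruct (open_locally_2d O x t hO h) as [d hd]. exists d. intros u v hu hv.
  specialize (hd u v hu hv). repeat split; eexists.
  + eapply diff_on_is_derive_x; eauto.
  + eapply diff_on_is_derive_t; eauto.
  + apply (diff_on_is_derive_x 0 O (dt f)); trivial. now apply diff_on_dt.
  + apply (diff_on_is_derive_t 0 O (Dx f)); trivial. now apply diff_on_Dx.
- apply (diff_on_continuity 0 O (Dx (dt f))); trivial.
  now apply diff_on_Dx, diff_on_dt.
- apply (diff_on_continuity 0 O (dt (Dx f))); trivial.
  now apply diff_on_dt, diff_on_Dx.
Qed.

Lemma locally_interval (a b x : R) : a < x < b -> locally x (fun y => a < y < b).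
Proof. intros h. apply (open_and (fun y => a < y) (fun y => y < b)); trivial; [apply open_gt|apply open_lt]. Qed.

Lemma Dx_eq_zero (f : R -> R -> R) (x t : R) :
  locally x (fun y => f y t = 0) -> Dx f x t = 0.
Proof.
intros h. unfold Dx. rewrite (Derive_ext_loc _ (fun _ => 0)) by easy.
apply Derive_const.
Qed.

Lemma locally_outside (a b p q x : R) :
  a < x < b -> ~ p <= x <= q -> locally x (fun y => a < y < b /\ ~ p <= y <= q).
Proof.
intros h n. apply filter_and; [now apply locally_interval|].
destruct (Rlt_dec x p) as [l|l].
- apply filter_imp with (fun y => y < p); [intros; lra|]. now apply open_lt.
- apply filter_imp with (fun y => q < y); [intros; lra|]. apply open_gt. lra.
Qed.

(* The infinitesimal time translation [dt U], localised in time by a bump. *)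
Definition time_shift (b1 b2 p q : R) (U : R -> R -> R) (x t : R) : R :=
  if excluded_middle_informative (b1 <= x <= b2) then bump p q t * dt U x t else 0.

Lemma time_shift_out (b1 b2 p q : R) (U : R -> R -> R) (x t : R) :
  ~ (b1 <= x <= b2 /\ p <= t <= q) -> time_shift b1 b2 p q U x t = 0.
Proof.
intros n. unfold time_shift. destruct excluded_middle_informative; trivial.
rewrite bump_out by lra. ring.
Qed.

(** The cutoff changes nothing here: outside [b1,b2] the function U vanishes throughout [0,tau],
    hence so does its two-sided time derivative at interior times. *)
Lemma time_shift_in (a1 a2 b1 b2 p q tau : R) (U : R -> R -> R) :
  (forall x t, a1 < x < a2 -> ~ b1 <= x <= b2 -> 0 <= t <= tau -> U x t = 0) ->
  forall x t, a1 < x < a2 -> 0 < t < tau ->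
  time_shift b1 b2 p q U x t = bump p q t * dt U x t.
Proof.
intros hU x t hx ht. unfold time_shift.
destruct excluded_middle_informative as [|n]; trivial.
unfold dt. rewrite (Derive_ext_loc _ (fun _ => 0)), Derive_const; [ring|].
generalize (locally_interval 0 tau t ht). apply filter_imp.
intros s hs. apply hU; trivial. lra.
Qed.

Lemma locally_2d_and (P Q : R -> Prop) (x t : R) :
  locally x P -> locally t Q -> locally_2d (fun u v => P u /\ Q v) x t.
Proof.
intros [d hd] [e he].
assert (h : 0 < Rmin d e) by (apply Rmin_pos; apply cond_pos).
exists (mkposreal _ h). simpl. intros u v hu hv. split.
- apply hd. apply Rlt_le_trans with (2 := Rmin_l d e). exact hu.
- apply he. apply Rlt_le_trans with (2 := Rmin_r d e). exact hv.
Qed.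

Lemma locally_not_Icc (p q x : R) :
  ~ p <= x <= q -> locally x (fun y => ~ p <= y <= q).
Proof.
intros n. apply filter_imp with (fun y => x - 1 < y < x + 1 /\ ~ p <= y <= q); [tauto|].
apply locally_outside; lra.
Qed.

(** The rectangle [b1,b2] x [p,q] lies inside the open strip. Near its points the function is the
    smooth product [bump * dt U], so the cutoff causes no jump at b1 or b2; away from it the
    function is locally zero. *)
Lemma time_shift_test_function (a1 a2 b1 b2 p q tau : R) (O : R * R -> Prop)
    (U : R -> R -> R) :
  a1 < b1 -> b2 < a2 -> 0 < p -> q < tau ->
  open O -> (forall n, diff_on n O U) ->
  (forall x t, a1 < x < a2 -> 0 <= t <= tau -> O (x, t)) ->
  (forall x t, a1 < x < a2 -> ~ b1 <= x <= b2 -> 0 <= t <= tau -> U x t = 0) ->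
  test_function a1 a2 tau (time_shift b1 b2 p q U).
Proof.
intros hb1 hb2 hp hq hO dU hB hU. split.
- intros n x t _.
  destruct (classic (b1 <= x <= b2 /\ p <= t <= q)) as [[hx ht]|h].
  + apply ex_diff_n_ext_loc with (fun x t => bump p q t * dt U x t).
    * destruct (locally_2d_and (fun u => a1 < u < a2) (fun v => 0 < v < tau) x t)
        as [d hd]; try (apply locally_interval; lra).
      exists d. intros u v hu hv. symmetry.
      destruct (hd u v hu hv). now apply time_shift_in with (1 := hU).
    * apply (diff_on_mult n O (fun _ t => bump p q t) (dt U)); trivial.
      -- intros y s _. now apply bump_diff_on.
      -- now apply diff_on_dt.
      -- apply hB; lra.
  + apply ex_diff_n_ext_loc with (fun _ _ => 0).
    2: now apply (diff_on_const n (fun _ => True)); [apply open_true|].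
    assert (hl : locally_2d (fun u v => ~ (b1 <= u <= b2 /\ p <= v <= q)) x t).
    { destruct (classic (b1 <= x <= b2)) as [hx|hx].
      - destruct (locally_2d_and (fun _ => True) (fun v => ~ p <= v <= q) x t)
          as [d hd]; [apply filter_true|apply locally_not_Icc; tauto|].
        exists d. intros u v hu hv. destruct (hd u v hu hv). tauto.
      - destruct (locally_2d_and (fun u => ~ b1 <= u <= b2) (fun _ => True) x t)
          as [d hd]; [now apply locally_not_Icc|apply filter_true|].
        exists d. intros u v hu hv. destruct (hd u v hu hv). tauto. }
    destruct hl as [d hd]. exists d. intros u v hu hv. symmetry.
    apply time_shift_out. auto.
- exists (fun z => b1 <= fst z <= b2 /\ p <= snd z <= q).
  split; [apply compact_rectangle|]. simpl. split.
  + intros x t h. lra.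
  + intros x t h. now apply time_shift_out.
Qed.

(** The Lagrangian is quadratic in the derivatives, so the action is exactly a polynomial of degree
    2 in [eps]. The first variation is its linear coefficient, and no differentiation under the
    integral is required. *)
Lemma action_perturbation (a1 a2 b1 b2 rho0 c tau : R) (O : R * R -> Prop)
    (u U phi : R -> R -> R) (eps : R) :
  a1 < b1 -> b1 <= b2 -> b2 < a2 -> 0 < tau ->
  open O -> (forall n, diff_on n O U) -> (forall n, diff_on n O phi) ->
  (forall x t, a1 < x < a2 -> 0 <= t <= tau -> O (x, t) /\ U x t = u x t) ->
  (forall x t, a1 < x < a2 -> ~ b1 <= x <= b2 -> 0 <= t <= tau -> U x t = 0) ->
  (forall x t, ~ b1 <= x <= b2 -> phi x t = 0) ->
  let I F := RInt (fun t => RInt (fun x => F x t) b1 b2) 0 tau in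
  action a1 a2 rho0 c tau (fun x t => u x t + eps * phi x t) =
  I (fun x t => rho0 / 2 * (dt U x t * dt U x t) + - (c / 2) * (Dx U x t * Dx U x t))
  + eps * I (fun x t => rho0 * (dt U x t * dt phi x t) + - c * (Dx U x t * Dx phi x t))
  + eps ^ 2 * I (fun x t => rho0 / 2 * (dt phi x t * dt phi x t)
                            + - (c / 2) * (Dx phi x t * Dx phi x t)).
Proof.
intros hb1 hb hb2 htau hO dU dphi hB hU hphi I.
assert (dF : forall k l f g f' g', diff_on 0 O f -> diff_on 0 O g ->
  diff_on 0 O f' -> diff_on 0 O g' ->
  diff_on 0 O (fun x t => k * (f x t * g x t) + l * (f' x t * g' x t))).
{ intros k l f g f' g' h1 h2 h3 h4. apply diff_on_plus; trivial;
    (apply diff_on_mult; trivial; [now apply diff_on_const|now apply diff_on_mult]). }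
assert (dUt := diff_on_dt 0 O U (dU 1%nat)).
assert (dUx := diff_on_Dx 0 O U (dU 1%nat)).
assert (dpt := diff_on_dt 0 O phi (dphi 1%nat)).
assert (dpx := diff_on_Dx 0 O phi (dphi 1%nat)).
assert (hB' : forall x t, b1 <= x <= b2 -> 0 <= t <= tau -> O (x, t)).
{ intros x t hx ht. apply hB; lra. }
assert (hin : forall F, diff_on 0 O F -> forall t, 0 <= t <= tau ->
  ex_RInt (fun x => F x t) b1 b2).
{ intros F hF t ht. apply ex_RInt_slice with 0%nat O; auto. }
assert (hout : forall F, diff_on 0 O F ->
  ex_RInt (fun t => RInt (fun x => F x t) b1 b2) 0 tau).
{ intros F hF. apply (ex_RInt_continuous (V := R_CompleteNormedModule)).
  rewrite Rmin_left, Rmax_right by lra. intros t ht.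
  apply continuous_RInt_slice with 0%nat O; auto. }
set (F0 := fun x t => rho0 / 2 * (dt U x t * dt U x t) + - (c / 2) * (Dx U x t * Dx U x t)).
set (F1 := fun x t => rho0 * (dt U x t * dt phi x t) + - c * (Dx U x t * Dx phi x t)).
set (F2 := fun x t => rho0 / 2 * (dt phi x t * dt phi x t)
                      + - (c / 2) * (Dx phi x t * Dx phi x t)).
assert (d0 : diff_on 0 O F0) by (apply dF; trivial).
assert (d1 : diff_on 0 O F1) by (apply dF; trivial).
assert (d2 : diff_on 0 O F2) by (apply dF; trivial).
unfold action, I. rewrite <- RInt_quadratic by auto.
apply RInt_ext. rewrite Rmin_left, Rmax_right by lra. intros t ht.
assert (ht' : 0 <= t <= tau) by lra.
rewrite <- (RInt_quadratic (fun x => F0 x t) (fun x => F1 x t) (fun x => F2 x t)) by auto.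
(* Off [b1,b2] the perturbed field vanishes at all times and at nearby x, so both its derivatives
   vanish. *)
assert (hz : forall x, a1 < x < a2 -> ~ b1 <= x <= b2 ->
  lagrangian rho0 c tau (fun x t => u x t + eps * phi x t) x t = 0).
{ intros x hx hx'. unfold lagrangian.
  rewrite (Dt_eq tau _ x t (fun _ => 0) 0); try lra.
  - rewrite Dx_eq_zero; [ring|].
    generalize (locally_outside a1 a2 b1 b2 x hx hx').
    apply filter_imp. intros y [hy hy'].
    rewrite <- (proj2 (hB y t hy ltac:(lra))), hU, hphi by (trivial; lra). ring.
  - intros s hs. rewrite <- (proj2 (hB x s hx hs)), hU, hphi by trivial. ring.
  - apply @is_derive_const. }
apply RInt_restrict; try lra.
- intros x hx. apply hz; lra.
- intros x hx. apply hz; lra.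
- intros x hx. assert (hx' : a1 < x < a2) by lra.
  assert (hOx : O (x, t)) by (apply hB'; lra).
  unfold lagrangian.
  rewrite (Dt_eq tau _ x t (fun s => U x s + eps * phi x s)
             (dt U x t + eps * dt phi x t)); try lra.
  + assert (e : Dx (fun x t => u x t + eps * phi x t) x t = Dx U x t + eps * Dx phi x t).
    { apply is_derive_unique.
      apply is_derive_ext_loc with (fun y => U y t + eps * phi y t).
      - generalize (locally_interval a1 a2 x hx'). apply filter_imp.
        intros y hy. now rewrite (proj2 (hB y t hy ltac:(lra))).
      - apply @is_derive_plus; [|apply is_derive_scal];
          apply diff_on_is_derive_x with 0%nat O; auto. }
    rewrite e. unfold F0, F1, F2. field.
  + intros s hs. now rewrite (proj2 (hB x s hx' hs)).
  + apply @is_derive_plus; [|apply is_derive_scal];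
      apply diff_on_is_derive_t with 0%nat O; auto.
- apply (hin (fun x t => F0 x t + eps * F1 x t + eps ^ 2 * F2 x t)); trivial.
  apply diff_on_plus; [trivial|apply diff_on_plus|]; trivial;
    (apply diff_on_mult; [trivial|now apply diff_on_const|trivial]).
Qed.

(** Built from the extension, this is both a smooth extension of the next field and, on the strip,
    the integrand of [energy]. *)
Definition energy_density (rho0 c : R) (U : R -> R -> R) (x t : R) : R :=
  rho0 / 2 * (dt U x t * dt U x t) + c / 2 * (Dx U x t * Dx U x t).

Lemma energy_density_diff_on (rho0 c : R) (O : R * R -> Prop) (U : R -> R -> R) :
  open O -> (forall n, diff_on n O U) ->
  forall n, diff_on n O (energy_density rho0 c U).
Proof.
intros hO dU n. apply diff_on_plus; trivial;
  (apply diff_on_mult; [trivial|now apply diff_on_const|apply diff_on_mult]); trivial;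
  now (apply diff_on_dt || apply diff_on_Dx).
Qed.

Lemma is_derive_energy_density (rho0 c : R) (O : R * R -> Prop) (U : R -> R -> R) x t :
  open O -> (forall n, diff_on n O U) -> O (x, t) ->
  dt (energy_density rho0 c U) x t =
  rho0 * dt U x t * dt (dt U) x t + c * Dx U x t * Dx (dt U) x t.
Proof.
intros hO dU h. rewrite (Dx_dt_comm O) by auto.
replace (rho0 * dt U x t * dt (dt U) x t + c * Dx U x t * dt (Dx U) x t) with
  (rho0 / 2 * (dt (dt U) x t * dt U x t + dt U x t * dt (dt U) x t) +
   c / 2 * (dt (Dx U) x t * Dx U x t + Dx U x t * dt (Dx U) x t)) by field.
apply is_derive_unique.
apply @is_derive_plus; apply is_derive_scal, is_derive_Rmult;
  apply diff_on_is_derive_t with 0%nat O; trivial;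
  now (apply diff_on_dt || apply diff_on_Dx).
Qed.

(* Noether's identity: testing with the localised time translation turns the
   integrand of the first variation into [2 d/dt (bump * kinetic energy)]
   minus [bump * d/dt (energy density)]. *)
Lemma weak_energy_conservation (a1 a2 b1 b2 rho0 c tau p q : R) (O : R * R -> Prop)
    (u U : R -> R -> R) :
  a1 < b1 -> b1 <= b2 -> b2 < a2 -> 0 < p -> p < q -> q < tau ->
  open O -> (forall n, diff_on n O U) ->
  (forall x t, a1 < x < a2 -> 0 <= t <= tau -> O (x, t) /\ U x t = u x t) ->
  (forall x t, a1 < x < a2 -> ~ b1 <= x <= b2 -> 0 <= t <= tau -> U x t = 0) ->
  solves_variational_problem a1 a2 rho0 c tau u ->
  RInt (fun t => bump p q t * RInt (fun x => dt (energy_density rho0 c U) x t) b1 b2)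
    0 tau = 0.
Proof.
intros hb1 hb hb2 hp hpq hq hO dU hB hU hvar.
assert (hB' : forall x t, b1 <= x <= b2 -> 0 <= t <= tau -> O (x, t)).
{ intros x t hx ht. apply hB; lra. }
set (phi := time_shift b1 b2 p q U).
assert (tphi : test_function a1 a2 tau phi).
{ apply time_shift_test_function with O; trivial. intros; now apply hB. }
set (M := fun x t => rho0 * (dt U x t * dt phi x t) + - c * (Dx U x t * Dx phi x t)).
assert (hM : RInt (fun t => RInt (fun x => M x t) b1 b2) 0 tau = 0).
{ specialize (hvar phi tphi).
  assert (dphi : forall n, diff_on n O phi) by (intros n x t _; now apply tphi).
  set (Q := RInt _ 0 tau).
  (* Only the linear coefficient Q matters: it is the derivative of the polynomial at eps = 0. *)
  assert (H : exists P S, forall eps,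
    action a1 a2 rho0 c tau (fun x t => u x t + eps * phi x t) = P + eps * Q + eps ^ 2 * S).
  { do 2 eexists. intros eps.
    apply action_perturbation with (O := O) (U := U); trivial; [lra|].
    intros x t hx. apply time_shift_out. tauto. }
  destruct H as [P [S H]].
  apply is_derive_unique in hvar. rewrite (Derive_ext _ _ _ H) in hvar.
  rewrite (is_derive_unique _ 0 Q) in hvar; trivial.
  clearbody Q. auto_derive; [trivial|simpl; ring]. }
(* G is the localised kinetic density b T of the identity. *)
set (G := fun x t => bump p q t * (rho0 / 2 * (dt U x t * dt U x t))).
assert (dG : forall n, diff_on n O G).
{ intros n. apply (diff_on_mult n O (fun _ t => bump p q t)); trivial.
  - intros y s _. now apply bump_diff_on.
  - apply diff_on_mult; [trivial|now apply diff_on_const|].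
    apply diff_on_mult; trivial; now apply diff_on_dt. }
assert (dE := energy_density_diff_on rho0 c O U hO dU).
assert (dGt := diff_on_dt 0 O G (dG 1%nat)).
assert (dEt := diff_on_dt 0 O _ (dE 1%nat)).
set (D := fun t => RInt (fun x => dt (energy_density rho0 c U) x t) b1 b2).
set (g := fun t => RInt (fun x => dt G x t) b1 b2).
assert (cD : forall t, 0 <= t <= tau -> continuous D t).
{ intros t ht. apply continuous_RInt_slice with 0%nat O; auto. }
assert (cg : forall t, 0 <= t <= tau -> continuous g t).
{ intros t ht. apply continuous_RInt_slice with 0%nat O; auto. }
assert (cb := bump_continuous p q).
(* Interior times suffice under the integral, and only there is [phi] known to be [bump * dt U]
   around t. *)
assert (hMt : forall t, 0 < t < tau ->
  RInt (fun x => M x t) b1 b2 = 2 * g t - bump p q t * D t).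
{ intros t ht.
  assert (i1 : ex_RInt (fun x => dt G x t) b1 b2).
  { apply ex_RInt_slice with 0%nat O; trivial. intros; apply hB'; lra. }
  assert (i2 : ex_RInt (fun x => dt (energy_density rho0 c U) x t) b1 b2).
  { apply ex_RInt_slice with 0%nat O; trivial. intros; apply hB'; lra. }
  apply is_RInt_unique.
  apply is_RInt_ext with
    (fun x => 2 * dt G x t - bump p q t * dt (energy_density rho0 c U) x t).
  2: { apply (is_RInt_minus (V := R_NormedModule));
       apply (is_RInt_scal (V := R_NormedModule));
       now apply (RInt_correct (V := R_CompleteNormedModule)). }
  rewrite Rmin_left, Rmax_right by easy. intros x hx.
  assert (hOx : O (x, t)) by (apply hB'; lra).
  assert (hx' : a1 < x < a2) by lra.
  assert (dbt := diff_on_is_derive_t 0 _ _ x t (bump_diff_on p q 1) I).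
  assert (dUt := diff_on_is_derive_t 0 O (dt U) x t (diff_on_dt 1 O U (dU 2%nat)) hOx).
  rewrite (is_derive_energy_density rho0 c O) by trivial.
  set (b' := dt (fun _ t => bump p q t) x t) in dbt.
  assert (eG : dt G x t = b' * (rho0 / 2 * (dt U x t * dt U x t)) +
    bump p q t * (rho0 / 2 * (dt (dt U) x t * dt U x t + dt U x t * dt (dt U) x t))).
  { apply is_derive_unique.
    apply (is_derive_Rmult (bump p q) (fun s => rho0 / 2 * (dt U x s * dt U x s)));
      trivial.
    apply (is_derive_scal (fun s => dt U x s * dt U x s)).
    now apply is_derive_Rmult. }
  assert (ephit : dt phi x t = b' * dt U x t + bump p q t * dt (dt U) x t).
  { apply is_derive_unique.
    apply is_derive_ext_loc with (fun s => bump p q s * dt U x s).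
    - generalize (locally_interval 0 tau t ht). apply filter_imp.
      intros s hs. symmetry. now apply time_shift_in with (1 := hU).
    - now apply (is_derive_Rmult (bump p q)). }
  assert (ephix : Dx phi x t = bump p q t * Dx (dt U) x t).
  { apply is_derive_unique.
    apply is_derive_ext_loc with (fun y => bump p q t * dt U y t).
    - generalize (locally_interval a1 a2 x hx'). apply filter_imp.
      intros s hs. symmetry. now apply time_shift_in with (1 := hU).
    - apply is_derive_scal, (diff_on_is_derive_x 0 O (dt U)); trivial.
      now apply diff_on_dt. }
  unfold M. rewrite eG, ephit, ephix. match goal with |- ?a = ?b => change (@eq R a b) end.
  field. }
(* The integral in time of a total derivative is the difference of its endpoint values, and the bump
   vanishes at 0 and tau. *)
assert (hg : is_RInt g 0 tau 0).
{ replace 0 with (minus (RInt (fun x => G x tau) b1 b2) (RInt (fun x => G x 0) b1 b2)) at 2.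
  - apply (is_RInt_derive (V := R_CompleteNormedModule)
      (fun t => RInt (fun x => G x t) b1 b2));
      rewrite Rmin_left, Rmax_right by lra; trivial.
    intros t ht. apply is_derive_RInt_slice with 0%nat O; auto.
  - unfold G. rewrite !bump_out by lra.
    rewrite (RInt_ext (fun x => 0 * (rho0 / 2 * (dt U x tau * dt U x tau)))
      (fun x => 0 * (rho0 / 2 * (dt U x 0 * dt U x 0)))) by (intros; simpl; ring).
    apply (minus_eq_zero (G := R_AbelianGroup)). }
assert (hD : ex_RInt (fun t => bump p q t * D t) 0 tau).
{ apply (ex_RInt_continuous (V := R_CompleteNormedModule)).
  rewrite Rmin_left, Rmax_right by lra. intros t ht.
  apply (continuous_mult (K := R_AbsRing)); auto. }
apply (RInt_correct (V := R_CompleteNormedModule)) in hD.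
assert (H := is_RInt_minus (V := R_NormedModule) _ _ _ _ _ _
  (is_RInt_scal (V := R_NormedModule) _ _ _ 2 _ hg) hD).
apply (is_RInt_unique (V := R_CompleteNormedModule)) in H.
rewrite <- (RInt_ext (fun t => RInt (fun x => M x t) b1 b2)) in H.
2: { rewrite Rmin_left, Rmax_right by lra. exact hMt. }
rewrite hM in H. unfold minus, plus, opp, scal in H. simpl in H.
unfold mult in H. simpl in H. change (RInt (fun t => bump p q t * D t) 0 tau = 0). lra.
Qed.

(** * From the weak identity to conservation *)

(** The fundamental lemma of the calculus of variations: if D t is nonzero, D keeps its sign on some
    [p,q] around t, where the bump is supported. Multiplying by the constant D t makes the integrand
    positive for either sign. *)
Lemma eq_zero_of_RInt_bump (tau : R) (D : R -> R) :
  (forall t, 0 <= t <= tau -> continuous D t) ->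
  (forall p q, 0 < p -> p < q -> q < tau -> RInt (fun t => bump p q t * D t) 0 tau = 0) ->
  forall t, 0 < t < tau -> D t = 0.
Proof.
intros cD h t ht. apply NNPP. intros hne.
assert (hp : 0 < Rabs (D t)) by now apply Rabs_pos_lt.
assert (hl : locally t (fun s => 0 < s < tau /\ Rabs (D s - D t) < Rabs (D t))).
{ apply filter_and; [now apply locally_interval|].
  apply (proj1 (filterlim_locally (F := locally t) D (D t)) (cD t ltac:(lra)) (mkposreal _ hp)). }
destruct hl as [d hd]. assert (d0 := cond_pos d).
(* Half the radius puts the closed interval [p,q] inside the ball. *)
set (p := t - d / 2). set (q := t + d / 2).
assert (hd' : forall s, p <= s <= q -> 0 < s < tau /\ 0 < D t * D s).
{ intros s hs. destruct (hd s) as [h1 h2].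
  - apply Rabs_def1; unfold minus, plus, opp; simpl; unfold p, q in hs; lra.
  - split; trivial. unfold Rabs in h2, hp. repeat destruct Rcase_abs; nra. }
assert (p0 := proj1 (hd' p ltac:(unfold p, q; lra))).
assert (q0 := proj1 (hd' q ltac:(unfold p, q; lra))).
assert (pq : p < q) by (unfold p, q; lra).
assert (cb := bump_continuous p q).
assert (cf : forall s, p <= s <= q -> continuous (fun s => D t * (bump p q s * D s)) s).
{ intros s hs. apply (continuous_scal_r (K := R_AbsRing) (V := R_NormedModule)).
  apply (continuous_mult (K := R_AbsRing)); [apply cb|].
  apply cD. assert (h' := hd' s hs). lra. }
assert (H : 0 < RInt (fun s => D t * (bump p q s * D s)) p q).
{ apply RInt_gt_0; trivial. intros s hs.
  assert (h' := proj2 (hd' s ltac:(lra))). assert (hb := bump_pos p q s hs). nra. }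
rewrite <- (RInt_restrict (fun s => D t * (bump p q s * D s)) _ 0 p q tau) in H;
  try lra; trivial.
- assert (i : ex_RInt (fun s => bump p q s * D s) 0 tau).
  { apply (ex_RInt_continuous (V := R_CompleteNormedModule)).
    rewrite Rmin_left, Rmax_right by lra. intros s hs.
    apply (continuous_mult (K := R_AbsRing)); auto. }
  assert (e := RInt_scal (V := R_CompleteNormedModule) _ _ _ (D t) i).
  rewrite h in e by lra.
  change (RInt (fun s => D t * (bump p q s * D s)) 0 tau = D t * 0) in e.
  rewrite e in H. lra.
- intros s hs. rewrite bump_out by lra. ring.
- intros s hs. rewrite bump_out by lra. ring.
- apply (ex_RInt_continuous (V := R_CompleteNormedModule)).
  rewrite Rmin_left, Rmax_right by lra. exact cf.
Qed.

(** For [Dt], agreement of u and U on [0,tau] suffices; for [Dx], agreement near x, which holds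
    because (a1,a2) is open. *)
Lemma field_derivatives (a1 a2 tau : R) (O : R * R -> Prop) (u U : R -> R -> R) (x t : R) :
  0 < tau -> (forall n, diff_on n O U) ->
  (forall x t, a1 < x < a2 -> 0 <= t <= tau -> O (x, t) /\ U x t = u x t) ->
  a1 < x < a2 -> 0 <= t <= tau -> Dt tau u x t = dt U x t /\ Dx u x t = Dx U x t.
Proof.
intros htau dU hB hx ht. split.
- apply Dt_eq with (fun s => U x s); trivial.
  + intros s hs. now rewrite (proj2 (hB x s hx hs)).
  + apply diff_on_is_derive_t with 0%nat O; trivial. now apply hB.
- apply Derive_ext_loc. generalize (locally_interval a1 a2 x hx). apply filter_imp.
  intros y hy. now rewrite (proj2 (hB y t hy ht)).
Qed.

Lemma energy_constant (a1 a2 rho0 c tau : R) (u : R -> R -> R) :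
  a1 < a2 -> 0 < tau -> smooth_field a1 a2 tau u ->
  solves_variational_problem a1 a2 rho0 c tau u -> compact_support_on a1 a2 tau u ->
  forall t, 0 <= t <= tau -> energy a1 a2 rho0 c tau u t = energy a1 a2 rho0 c tau u 0.
Proof.
intros ha htau [O [U [hO [dU' hB]]]] hvar [K [cK [inK hK]]].
assert (dU : forall n, diff_on n O U) by (intros n x t; apply dU').
destruct (compact_in_interval a1 a2 K ha cK inK) as [b1 [b2 [hb1 [hb [hb2 hKb]]]]].
assert (hb' : b1 <= b2) by lra.
assert (hu : forall x t, a1 < x < a2 -> ~ b1 <= x <= b2 -> 0 <= t <= tau -> u x t = 0).
{ intros x t hx n ht. apply hK; trivial. intros k. now apply n, hKb. }
assert (hU : forall x t, a1 < x < a2 -> ~ b1 <= x <= b2 -> 0 <= t <= tau -> U x t = 0).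
{ intros x t hx n ht. rewrite (proj2 (hB x t hx ht)). now apply hu. }
assert (hB' : forall t x, 0 <= t <= tau -> b1 <= x <= b2 -> O (x, t)).
{ intros t x hx ht. apply hB; lra. }
set (E := energy_density rho0 c U).
assert (dE : forall n, diff_on n O E) by now apply energy_density_diff_on.
set (H := fun t => RInt (fun x => E x t) b1 b2).
assert (eH : forall t, 0 <= t <= tau -> energy a1 a2 rho0 c tau u t = H t).
{ intros t ht.
  assert (hz : forall x, a1 < x < a2 -> ~ b1 <= x <= b2 ->
    1 / 2 * (rho0 * (Dt tau u x t) ^ 2 + c * (Dx u x t) ^ 2) = 0).
  { intros x hx hx'. rewrite (Dt_eq tau u x t (fun _ => 0) 0); trivial.
    - rewrite Dx_eq_zero; [ring|].
      generalize (locally_outside a1 a2 b1 b2 x hx hx'). apply filter_imp.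
      intros y [hy hy']. now apply hu.
    - intros s hs. now apply hu.
    - apply @is_derive_const. }
  apply RInt_restrict; try lra.
  - intros x hx. apply hz; lra.
  - intros x hx. apply hz; lra.
  - intros x hx.
    destruct (field_derivatives a1 a2 tau O u U x t htau dU hB ltac:(lra) ht) as [-> ->].
    unfold E, energy_density. field.
  - apply (ex_RInt_slice 0 O E); auto. }
set (D := fun t => RInt (fun x => dt E x t) b1 b2).
assert (dH : forall t, 0 <= t <= tau -> is_derive H t (D t)).
{ intros t ht. apply is_derive_RInt_slice with 0%nat O; auto. }
assert (hD : forall t, 0 < t < tau -> D t = 0).
{ apply eq_zero_of_RInt_bump.
  - intros t ht. apply continuous_RInt_slice with 0%nat O; auto. now apply diff_on_dt.
  - intros p q hp hpq hq.
    exact (weak_energy_conservation a1 a2 b1 b2 rho0 c tau p q O u U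
      hb1 hb' hb2 hp hpq hq hO dU hB hU hvar). }
(* The derivative of H is known to vanish at interior times only; the mean value theorem asks no
   more than that, together with continuity up to 0 and tau. *)
intros t ht. rewrite !eH by lra.
destruct (MVT_gen H 0 t (fun _ => 0)) as [s [_ hs]].
- rewrite Rmin_left, Rmax_right by lra. intros s hs.
  rewrite <- (hD s) by lra. apply dH. lra.
- rewrite Rmin_left, Rmax_right by lra. intros s hs.
  apply derivable_continuous_pt, ex_derive_Reals_0. exists (D s). apply dH. lra.
- lra.
Qed.

Lemma smooth_field_energy_density (a1 a2 rho0 c tau : R) (u : R -> R -> R) :
  0 < tau -> smooth_field a1 a2 tau u ->
  smooth_field a1 a2 tau
    (fun x t => rho0 / 2 * (Dt tau u x t) ^ 2 + c / 2 * (Dx u x t) ^ 2).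
Proof.
intros htau [O [U [hO [dU' hB]]]].
assert (dU : forall n, diff_on n O U) by (intros n x t; apply dU').
exists O, (energy_density rho0 c U). split; [trivial|split].
- intros n x t. now apply energy_density_diff_on.
- intros x t hx ht. split; [now apply hB|].
  destruct (field_derivatives a1 a2 tau O u U x t htau dU hB hx ht) as [-> ->].
  unfold energy_density. ring.
Qed.

Theorem corollary2 (a1 a2 tau rho0 c : R) (u0 : R -> R -> R)
    (ha : a1 < a2) (htau : 0 < tau) (hrho0 : 0 < rho0) (hc : 0 < c)
    (hsmooth : smooth_field a1 a2 tau u0)
    (hvar : forall i : nat,
        solves_variational_problem a1 a2 rho0 c tau (field rho0 c tau u0 i))
    (hsupp : forall i : nat,
        compact_support_on a1 a2 tau (field rho0 c tau u0 i)) :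
  forall (i : nat) (t : R), 0 <= t <= tau ->
    energy a1 a2 rho0 c tau (field rho0 c tau u0 i) t =
    energy a1 a2 rho0 c tau (field rho0 c tau u0 i) 0.
Proof.
intros i. apply energy_constant; trivial.
(* Smoothness alone is inherited from field to field; the variational property and the compact
   support are assumed at every index. *)
induction i as [|i IH]; [trivial|now apply smooth_field_energy_density].
Qed.
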